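(* Let $\beta$ be a Parry number with Parry polynomial $n_\beta^*(X)$ and minimal polynomial $P_\beta(X)$. Then every irreducible factor of $n_\beta^*(X)$ in $\mathbb{Z}[X]$, other than $P_\beta(X)$, which is not cyclotomic has at least one root of modulus $>1$.
   Context: For non-integer $\beta>1$, $d_\beta(1)=0.t_1t_2\ldots$ with $t_1=\lfloor\beta\rfloor$, $t_{j+1}=\lfloor\beta T_\beta^j(1)\rfloor$, $T_\beta(x)=\beta x-\lfloor\beta x\rfloor$; $\beta$ is a Parry number if $(t_i)$ is eventually periodic. Parry polynomial: if $t_i=0$ for $i>m$, $t_m\neq0$: $n_\beta^*(X)=X^m-\sum_{i=1}^mt_iX^{m-i}$; otherwise with minimal preperiod $m\ge0$ and period $p+1$: if $m\ge1$, $n_\beta^*(X)=X^{m+p+1}-\sum_{i=1}^{m+p+1}t_iX^{m+p+1-i}-X^m+\sum_{i=1}^mt_iX^{m-i}$; if $m=0$, $n_\beta^*(X)=X^{p+1}-\sum_{i=1}^pt_iX^{p+1-i}-(1+t_{p+1})$. It is monic in $\mathbb{Z}[X]$ and divisible by $P_\beta$. *)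

(* Defs.v *)
From HB Require Import structures.
From mathcomp Require Import all_boot all_order all_algebra all_field.
From mathcomp Require Import complex.
From mathcomp Require Import reals.
Set Implicit Arguments.
Unset Strict Implicit.
Unset Printing Implicit Defensive.
Import Order.TTheory GRing.Theory Num.Theory.
Local Open Scope ring_scope.

Definition beta_transform (R : realType) (beta x : R) : R :=
  beta * x - (Num.floor (beta * x))%:~R.

(* The Renyi digits t_1, t_2, ... of d_beta(1).  Digits are indexed from 1;
   the value at index 0 is junk and is never consulted below. *)
Definition renyi_digit (R : realType) (beta : R) (i : nat) : int :=
  Num.floor (beta * iter i.-1 (beta_transform beta) 1).

(* t_(i + p + 1) = t_i for all i > m: preperiod m and period p + 1, neither
   required to be minimal. *)
Definition eventually_periodic (t : nat -> int) (m p : nat) : Prop :=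
  forall i : nat, (m < i)%N -> t (i + p.+1)%N = t i.

Definition minimally_periodic (t : nat -> int) (m p : nat) : Prop :=
  eventually_periodic t m p /\
  forall m' p' : nat, eventually_periodic t m' p' -> (m <= m')%N /\ (p <= p')%N.

Definition finite_expansion (t : nat -> int) (m : nat) : Prop :=
  [/\ (0 < m)%N, t m <> 0 & forall i : nat, (m < i)%N -> t i = 0].

Definition parry_number (R : realType) (beta : R) : Prop :=
  [/\ 1 < beta, (forall k : int, beta <> k%:~R)
    & exists m p : nat, eventually_periodic (renyi_digit beta) m p].

(* parry_polynomial_of t n: n is the Parry polynomial attached to the digit
   sequence t. *)
Variant parry_polynomial_of (t : nat -> int) : {poly int} -> Prop :=
| ParryFinite (m : nat) of finite_expansion t m :
    parry_polynomial_of t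
      ('X^m - \sum_(1 <= i < m.+1) (t i)%:P * 'X^(m - i))
| ParryPreperiodic (m p : nat) of
      (forall k : nat, ~ finite_expansion t k) & minimally_periodic t m p
      & (0 < m)%N :
    parry_polynomial_of t
      ('X^(m + p + 1)
       - \sum_(1 <= i < (m + p + 1).+1) (t i)%:P * 'X^(m + p + 1 - i)
       - 'X^m + \sum_(1 <= i < m.+1) (t i)%:P * 'X^(m - i))
| ParryPurelyPeriodic (p : nat) of
      (forall k : nat, ~ finite_expansion t k) & minimally_periodic t 0 p :
    parry_polynomial_of t
      ('X^(p + 1) - \sum_(1 <= i < p.+1) (t i)%:P * 'X^(p + 1 - i)
       - (1 + t (p + 1)%N)%:P).

Definition parry_polynomial (R : realType) (beta : R) (n : {poly int}) : Prop :=
  parry_polynomial_of (renyi_digit beta) n.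

(* The minimal polynomial over the rationals of an algebraic integer, which has
   integer coefficients. *)
Definition minimal_polynomial (R : realType) (beta : R) (P : {poly int}) : Prop :=
  [/\ P \is monic, root (map_poly intr P) beta
    & forall f : {poly rat}, f != 0 -> root (map_poly ratr f) beta ->
        (size P <= size f)%N].

(* Irreducibility as an element of the ring Z[X]; the library's
   irreducible_poly rests on pseudo-division, hence over int on divisibility up
   to integer scalars. *)
Definition irreducible_Zpoly (q : {poly int}) : Prop :=
  [/\ q != 0, q \isn't a GRing.unit
    & forall a b : {poly int}, q = a * b ->
        a \is a GRing.unit \/ b \is a GRing.unit].

Definition divides_Zpoly (q n : {poly int}) : Prop :=
  exists r : {poly int}, n = q * r.

(* The units of Z[X] are 1 and -1. *)
Definition associated_Zpoly (p q : {poly int}) : Prop := p = q \/ p = - q.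

Definition cyclotomic_Zpoly (q : {poly int}) : Prop :=
  exists2 k : nat, (0 < k)%N & associated_Zpoly q 'Phi_k.

(* Main.v *)
Require Import Defs.
From HB Require Import structures.
From mathcomp Require Import all_boot all_order all_algebra all_field.
From mathcomp Require Import complex.
From mathcomp Require Import boolp reals.
Set Implicit Arguments.
Unset Strict Implicit.
Unset Printing Implicit Defensive.
Import Order.TTheory GRing.Theory Num.Theory.
Local Open Scope ring_scope.

(** Put c_m := X^m - (t_1 X^(m-1) + ... + t_m).  The Parry polynomial n is c_m
    for a finite expansion of length m and c_(m+p+1) - c_m for preperiod m and
    period p + 1.  Since c_0 = 1 and c_m(0) = - t_m for m > 0, n is monic and
    n(0) is nonzero, by minimality of the preperiod or nonnegativity of the
    digits.  Hence an irreducible factor q of n has leading coefficient 1 or -1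
    and nonzero roots.  If no root of q lay outside the unit disk, Kronecker's
    theorem would make every root of q a root of unity, and q would be
    cyclotomic. *)

Definition graeffe (R : nzRingType) (p : {poly R}) : {poly R} :=
  even_poly p ^+ 2 - odd_poly p ^+ 2 * 'X.

Lemma graeffe_comp_sqr (R : comNzRingType) (p : {poly R}) :
  graeffe p \Po 'X^2 = p * (p \Po - 'X).
Proof.
have sqrNX : 'X^2 \Po - 'X = 'X^2 :> {poly R} by rewrite comp_Xn_poly sqrrN.
rewrite /graeffe comp_polyB !(comp_polyM, expr2) comp_polyX -!expr2.
rewrite -[_ * 'X^2]exprMn subr_sqr mulrC.
rewrite -{5 6}(poly_even_odd p) comp_polyD comp_polyM comp_polyX -!comp_polyA.
by rewrite sqrNX mulrN.
Qed.

Lemma horner_graeffe_sqr (R : comNzRingType) (p : {poly R}) z :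
  (graeffe p).[z ^+ 2] = p.[z] * p.[- z].
Proof.
have := congr1 (horner^~ z) (graeffe_comp_sqr p).
by rewrite hornerM !horner_comp hornerXn hornerN hornerX.
Qed.

Lemma root_graeffe_sqr (R : comNzRingType) (p : {poly R}) z :
  root p z -> root (graeffe p) (z ^+ 2).
Proof. by move=> /rootP pz0; rewrite /root horner_graeffe_sqr pz0 mul0r. Qed.

Lemma size_graeffe (R : idomainType) (p : {poly R}) :
  size (graeffe p) = size p.
Proof.
have [->|p_neq0] := eqVneq p 0.
  by rewrite /graeffe -polyC0 even_polyC odd_polyC polyC0 expr0n mul0r subr0.
have size_NX : size (- 'X : {poly R}) = 2 by rewrite size_polyN size_polyX.
have pN_neq0 : p \Po - 'X != 0 by rewrite comp_poly2_eq0.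
have graeffe_neq0 : graeffe p != 0.
  by rewrite -(@comp_poly_eq0 _ _ 'X^2) ?size_polyXn //
    graeffe_comp_sqr mulf_neq0.
have := size_comp_poly (graeffe p) 'X^2.
rewrite graeffe_comp_sqr size_mul // size_comp_poly2 // size_polyXn /= muln2.
have := p_neq0; have := graeffe_neq0; rewrite -!size_poly_gt0.
case: (size p) (size (graeffe p)) => // m [//|k] _ _ /=.
by rewrite addnS /= addnn => /double_inj ->.
Qed.

Lemma lead_coef_graeffe (R : idomainType) (p : {poly R}) :
  lead_coef (graeffe p) = (-1) ^+ (size p).-1 * lead_coef p ^+ 2.
Proof.
have := lead_coef_comp (graeffe p) (q := 'X^2).
rewrite size_polyXn lead_coefXn expr1n mulr1 => /(_ isT) <-.
rewrite graeffe_comp_sqr lead_coefM lead_coef_comp ?size_polyN ?size_polyX //.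
by rewrite lead_coefN lead_coefX mulrA mulrC -expr2.
Qed.

Lemma map_graeffe (R S : nzRingType) (f : {rmorphism R -> S}) (p : {poly R}) :
  map_poly f (graeffe p) = graeffe (map_poly f p).
Proof.
have map_even : map_poly f (even_poly p) = even_poly (map_poly f p).
  by apply/polyP => i; rewrite !(coef_map, coef_even_poly).
have map_odd : map_poly f (odd_poly p) = odd_poly (map_poly f p).
  by apply/polyP => i; rewrite !(coef_map, coef_odd_poly).
by rewrite /graeffe !expr2 rmorphB !rmorphM /= map_polyX map_even map_odd.
Qed.

Definition roots_in_unit_disk (R : numDomainType) (p : {poly R}) : Prop :=
  forall z, root p z -> `|z| <= 1.

Lemma roots_in_unit_disk_graeffe (C : numClosedFieldType) (p : {poly C}) :
  roots_in_unit_disk p -> roots_in_unit_disk (graeffe p).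
Proof.
move=> p_disk z; rewrite -[z]sqrtCK /root horner_graeffe_sqr mulf_eq0 normrX.
by case/orP => /p_disk; rewrite ?normrN => w_le1; rewrite expr_le1.
Qed.

Lemma norm_coef_prod_XsubC (R : numDomainType) (r : seq R) i :
  {in r, forall z, `|z| <= 1} ->
  `|(\prod_(z <- r) ('X - z%:P))`_i| <= 2 ^+ size r.
Proof.
elim: r i => [|z r IHr] i r_le1.
  by rewrite big_nil coef1 normr_nat lern1 leq_b1.
have {}IHr j : `|(\prod_(w <- r) ('X - w%:P))`_j| <= 2 ^+ size r.
  by apply: IHr => w wr; rewrite r_le1 // in_cons wr orbT.
rewrite big_cons mulrBl coefB coefXM coefCM exprS mulr_natl mulr2n.
apply: le_trans (ler_normB _ _) _; apply: lerD.
  by case: ifP => // _; rewrite normr0 exprn_ge0.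
by rewrite normrM -[leRHS]mul1r ler_pM // r_le1 ?mem_head.
Qed.

Lemma norm_coef_roots_in_unit_disk (C : numClosedFieldType) (p : {poly C}) i :
  roots_in_unit_disk p -> `|p`_i| <= `|lead_coef p| * 2 ^+ (size p).-1.
Proof.
have [-> _|p_neq0 p_disk] := eqVneq p 0.
  by rewrite coef0 lead_coef0 normr0 mul0r.
have [r p_def] := closed_field_poly_normal p.
have lead_neq0 : lead_coef p != 0 by rewrite lead_coef_eq0.
have -> : (size p).-1 = size r.
  by rewrite p_def size_scale // size_prod_XsubC.
rewrite [in p`_i]p_def coefZ normrM ler_wpM2l // norm_coef_prod_XsubC //.
by move=> z zr; apply: p_disk; rewrite p_def rootZ // root_prod_XsubC.
Qed.

Lemma finite_polys_coef_in (R : nzSemiRingType) (cs : seq R) (d : nat) :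
  exists s : seq {poly R}, forall p : {poly R},
    (size p <= d)%N -> (forall i, p`_i \in cs) -> p \in s.
Proof.
elim: d => [|d [s s_polys]].
  by exists [:: 0] => p; rewrite leqn0 size_poly_eq0 inE.
exists [seq cons_poly c q | c <- cs, q <- s] => p size_p p_cs.
have -> : p = cons_poly p`_0 (drop_poly 1 p).
  by apply/polyP => -[|i]; rewrite coef_cons //= coef_drop_poly addn1.
apply: allpairs_f (p_cs 0%N) (s_polys _ _ _).
  by rewrite size_drop_poly leq_subLR.
by move=> i; rewrite coef_drop_poly.
Qed.

Lemma bounded_Zpoly_common_multiple (R : numDomainType) (d B : nat) :
  exists2 m : {poly R}, m != 0
    & forall (p : {poly int}) z, p != 0 -> (size p <= d)%N ->
        (forall i, `|p`_i| <= B%:Z) -> root (map_poly intr p) z -> root m z.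
Proof.
pose cs := [seq k%:Z - B%:Z | k <- iota 0 B.*2.+1].
have mem_cs (a : int) : `|a| <= B%:Z -> a \in cs.
  rewrite ler_norml => /andP [a_ge a_le]; apply/mapP; exists `|(a + B%:Z)%R|%N.
    rewrite mem_iota leq0n add0n ltnS -lez_nat gez0_abs -?lerBlDr ?sub0r //.
    by rewrite -addnn PoszD lerD2r.
  by rewrite gez0_abs ?addrK // -lerBlDr sub0r.
have [s s_polys] := finite_polys_coef_in cs d.
exists (\prod_(p <- s | p != 0) map_poly intr p).
  rewrite prodf_seq_neq0; apply/allP => p _; apply/implyP => p_neq0.
  by rewrite map_poly_eq0_id0 // intr_eq0 lead_coef_eq0.
move=> p z p_neq0 size_p p_le pz.
have p_s : p \in s by apply: s_polys => // i; apply: mem_cs.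
by rewrite (big_rem p) //= p_neq0 rootM pz.
Qed.

Lemma root_exprs_unity (R : idomainType) (m : {poly R}) (z : R)
    (e : nat -> nat) :
  m != 0 -> z != 0 -> {homo e : i j / (i < j)%N} ->
  (forall j, root m (z ^+ e j)) -> exists2 k, (0 < k)%N & z ^+ k = 1.
Proof.
move=> m_neq0 z_neq0 e_homo m_roots.
pose s := [seq z ^+ e j | j <- iota 0 (size m)].
have /(uniqPn 0) [i [j [lt_ij]]] : ~~ uniq s.
  have s_roots : all (root m) s by apply/allP => _ /mapP [j _ ->].
  apply/negP => /(max_poly_roots m_neq0 s_roots).
  by rewrite size_map size_iota ltnn.
rewrite size_map size_iota => lt_j; have lt_i := ltn_trans lt_ij lt_j.
rewrite !(nth_map 0%N) ?size_iota // !nth_iota // !add0n => eq_ij.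
have lt_e := e_homo _ _ lt_ij.
exists (e j - e i)%N; first by rewrite subn_gt0.
by apply: (mulfI (expf_neq0 (e i) z_neq0)); rewrite mulr1 -exprD subnKC // ltnW.
Qed.

(* Graeffe's transform squares the roots and keeps the degree and the bound on
   the roots, so the powers z^(2^j) are roots of integer polynomials of bounded
   degree and height. *)
Lemma kronecker (C : numClosedFieldType) (p : {poly int}) (z : C) :
  lead_coef p \is a GRing.unit ->
  roots_in_unit_disk (map_poly intr p : {poly C}) ->
  root (map_poly intr p) z -> z != 0 ->
  exists2 k, (0 < k)%N & z ^+ k = 1.
Proof.
move=> p_lead p_disk pz z_neq0; pose g j := iter j (@graeffe int) p.
have g_lead j : `|lead_coef (g j)| = 1.
  elim: j => [|j IHj] /=; first by case/orP: p_lead => /eqP ->.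
  by rewrite lead_coef_graeffe normrM !normrX normrN1 IHj !expr1n mulr1.
have g_neq0 j : g j != 0 by rewrite -lead_coef_eq0 -normr_gt0 g_lead.
have g_size j : size (g j) = size p.
  by elim: j => //= j IHj; rewrite size_graeffe.
have g_disk j : roots_in_unit_disk (map_poly intr (g j) : {poly C}).
  elim: j => //= j IHj; rewrite map_graeffe.
  exact: roots_in_unit_disk_graeffe.
have g_root j : root (map_poly intr (g j)) (z ^+ (2 ^ j)).
  elim: j => //= j IHj; rewrite map_graeffe expnSr exprM.
  exact: root_graeffe_sqr.
have g_coef j i : `|(g j)`_i| <= (2 ^ (size p).-1)%N%:Z.
  have := norm_coef_roots_in_unit_disk i (g_disk j).
  have intC_inj := @intr_inj C.
  rewrite coef_map lead_coef_map_inj // size_map_inj_poly // g_size.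
  by rewrite -!intr_norm g_lead mul1r -natrX pmulrn ler_int.
have [m m_neq0 m_roots] :=
  bounded_Zpoly_common_multiple C (size p) (2 ^ (size p).-1).
apply: (root_exprs_unity m_neq0 z_neq0 (e := expn 2)) => [i j|j].
  by rewrite ltn_exp2l.
by apply: m_roots (g_root j); rewrite ?g_size.
Qed.

Lemma map_poly_ratr_intr (F : numFieldType) (p : {poly int}) :
  map_poly ratr (map_poly intr p : {poly rat}) = map_poly intr p :> {poly F}.
Proof.
by rewrite -map_poly_comp; apply: eq_map_poly => a /=; rewrite ratr_int.
Qed.

Lemma irreducible_dvdp_common_root (F K : fieldType) (f : {rmorphism F -> K})
    (p q : {poly F}) (z : K) :
  irreducible_poly p -> root (map_poly f p) z -> root (map_poly f q) z ->
  p %| q.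
Proof.
move=> p_irr pz; apply: contraTT; rewrite -irreducible_poly_coprime //.
by rewrite -(coprimep_map f) => /coprimep_root; apply.
Qed.

Lemma irreducible_Cyclotomic (n : nat) :
  (0 < n)%N -> irreducible_poly (map_poly intr 'Phi_n : {poly rat}).
Proof.
move=> n_gt0; split=> [|f size_f f_dvd].
  by rewrite size_rat_int_poly size_Cyclotomic ltnS totient_gt0.
have [w fw] : exists w : algC, root (map_poly ratr f) w.
  by apply/closed_rootP; rewrite size_map_poly.
have [z z_prim] := C_prim_root_exists n_gt0.
have w_prim : n.-primitive_root w.
  rewrite -(root_cyclotomic z_prim) -(Cintr_Cyclotomic z_prim).
  by rewrite -map_poly_ratr_intr; apply: root_dvdp fw; rewrite dvdp_map.
have [p [minC_p _] p_dvd] := minCpolyP w.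
have p_Phi : p = map_poly intr 'Phi_n.
  apply: (map_poly_inj (ratr : {rmorphism rat -> algC})).
  rewrite -minC_p (minCpoly_cyclotomic w_prim) -(Cintr_Cyclotomic w_prim).
  exact: esym (map_poly_ratr_intr _ _).
by rewrite /eqp f_dvd -p_Phi -p_dvd.
Qed.

Lemma root_unity_Cyclotomic (R : idomainType) (k : nat) (z : R) :
  (0 < k)%N -> z ^+ k = 1 ->
  exists2 d, (0 < d)%N & root (map_poly intr 'Phi_d) z.
Proof.
move=> k_gt0 zk1.
have : root (map_poly intr (\prod_(d <- divisors k) 'Phi_d)) z.
  rewrite prod_Cyclotomic // rmorphB /= map_polyXn rmorph1.
  by rewrite /root !hornerE zk1 subrr.
rewrite rmorph_prod /root horner_prod prodf_seq_eq0 => /hasP [d].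
rewrite -dvdn_divisors // => d_dvd_k Phi_z; exists d => //.
exact: dvdn_gt0 d_dvd_k.
Qed.

Lemma irreducible_Zpoly_associated (p q : {poly int}) :
  irreducible_Zpoly q -> divides_Zpoly p q -> p \isn't a GRing.unit ->
  associated_Zpoly q p.
Proof.
move=> [_ _ q_irr] [r q_def] p_nunit.
have [/(negP p_nunit) //|] := q_irr _ _ q_def.
rewrite poly_unitE q_def => /andP [/eqP/eq_leq/size1_polyC ->].
rewrite coefC eqxx => /orP [] /eqP ->; [left|right].
  by rewrite mulr1.
by rewrite polyCN mulrN1.
Qed.

Lemma irreducible_root_unity_cyclotomic (F : numFieldType)
    (q : {poly int}) (z : F) (k : nat) :
  irreducible_Zpoly q -> root (map_poly intr q) z ->
  (0 < k)%N -> z ^+ k = 1 -> cyclotomic_Zpoly q.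
Proof.
move=> q_irr qz k_gt0 zk1.
have [d d_gt0 Phi_z] := root_unity_Cyclotomic k_gt0 zk1.
exists d => //; apply: irreducible_Zpoly_associated => //.
  have [r ->] : exists r, q = r * 'Phi_d.
    apply/(Pdiv.IdomainMonic.dvdpP (Cyclotomic_monic d)).
    rewrite -dvdp_rat_int.
    apply: (irreducible_dvdp_common_root (f := ratr) (z := z)).
    - exact: irreducible_Cyclotomic.
    - by rewrite map_poly_ratr_intr.
    - by rewrite map_poly_ratr_intr.
  by exists r; rewrite mulrC.
by rewrite poly_unitE size_Cyclotomic eqSS -leqn0 leqNgt totient_gt0 d_gt0.
Qed.

Lemma irreducible_Zpoly_size_neq1 (q : {poly int}) :
  irreducible_Zpoly q -> lead_coef q \is a GRing.unit -> size q != 1.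
Proof.
move=> [_ q_nunit _] q_lead; apply: contraNneq q_nunit => size_q.
by rewrite poly_unitE size_q eqxx; move: q_lead; rewrite lead_coefE size_q.
Qed.

Lemma irreducible_in_unit_disk_cyclotomic (C : numClosedFieldType)
    (q : {poly int}) :
  irreducible_Zpoly q -> lead_coef q \is a GRing.unit -> q`_0 != 0 ->
  roots_in_unit_disk (map_poly intr q : {poly C}) -> cyclotomic_Zpoly q.
Proof.
move=> q_irr q_lead q0_neq0 q_disk.
have [z qz] : exists z : C, root (map_poly intr q) z.
  apply/closed_rootP; rewrite (size_map_inj_poly (@intr_inj C)) //.
  exact: irreducible_Zpoly_size_neq1.
have z_neq0 : z != 0.
  by apply: contraTneq qz => ->; rewrite /root horner_coef0 coef_map intr_eq0.
have [k k_gt0 zk1] := kronecker q_lead q_disk qz z_neq0.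
exact: irreducible_root_unity_cyclotomic qz k_gt0 zk1.
Qed.

(* If t is the digit sequence of beta, the value at beta is the m-th iterate of
   1 under the beta-transformation. *)
Fixpoint remainder_poly (R : nzRingType) (t : nat -> R) (m : nat) : {poly R} :=
  if m is k.+1 then remainder_poly t k * 'X - (t k.+1)%:P else 1.

Lemma remainder_polyE (R : nzRingType) (t : nat -> R) (m : nat) :
  remainder_poly t m = 'X^m - \sum_(1 <= i < m.+1) (t i)%:P * 'X^(m - i).
Proof.
elim: m => [|m IHm] /=; first by rewrite big_geq // subr0.
rewrite big_nat_recr //= subnn mulr1 IHm mulrBl -exprSr opprD addrA mulr_suml.
congr (_ - _ - _); apply: eq_big_nat => i /andP [_ le_im].
by rewrite subSn // exprSr mulrA.
Qed.

Lemma size_remainder_poly (R : nzRingType) (t : nat -> R) (m : nat) :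
  size (remainder_poly t m) = m.+1.
Proof.
elim: m => [|m IHm] /=; first by rewrite size_poly1.
by rewrite -polyCN size_MXaddC -size_poly_eq0 IHm.
Qed.

Lemma monic_remainder_poly (R : nzRingType) (t : nat -> R) (m : nat) :
  remainder_poly t m \is monic.
Proof.
elim: m => [|m /monicP monic_m] /=; first exact: monic1.
rewrite monicE lead_coefDl ?lead_coefMX ?monic_m // size_polyN.
rewrite size_mulX -?size_poly_gt0 size_remainder_poly //.
exact: leq_ltn_trans (size_polyC_leq1 _) _.
Qed.

Lemma coef0_remainder_poly (R : nzRingType) (t : nat -> R) (m : nat) :
  (remainder_poly t m)`_0 = if m is k.+1 then - t k.+1 else 1.
Proof. by case: m => [|k] /=; rewrite ?coef1 // coefB coefMX coefC sub0r. Qed.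

Lemma monic_remainder_polyB (R : nzRingType) (t : nat -> R) (m k : nat) :
  (m < k)%N -> remainder_poly t k - remainder_poly t m \is monic.
Proof.
move=> lt_mk; rewrite monicE lead_coefDl ?size_polyN ?size_remainder_poly //.
by rewrite (monicP (monic_remainder_poly t k)).
Qed.

Lemma parry_polynomial_ofE (t : nat -> int) (n : {poly int}) :
  parry_polynomial_of t n ->
  (exists2 m, finite_expansion t m & n = remainder_poly t m) \/
  exists m p, minimally_periodic t m p /\
    n = remainder_poly t (m + p.+1) - remainder_poly t m.
Proof.
case=> [m t_fin|m p _ t_per _|p _ t_per].
- by left; exists m; rewrite // remainder_polyE.
- right; exists m, p; split => //.
  by rewrite !remainder_polyE -addnA addn1 opprB addrA addrAC.
- right; exists 0%N, p; split => //.
  rewrite add0n addn1 remainder_polyE [in RHS]big_nat_recr //= subnn mulr1.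
  by rewrite polyCD polyC1 !opprD !addrA addrAC.
Qed.

Lemma minimally_periodic_preperiod_neq (t : nat -> int) (m p : nat) :
  minimally_periodic t m.+1 p -> t (m.+1 + p.+1)%N != t m.+1.
Proof.
move=> [t_per t_min]; apply/eqP => t_eq.
have [|] := t_min m p; last by rewrite ltnn.
by move=> i; rewrite leq_eqVlt => /orP [/eqP <- | /t_per].
Qed.

Lemma monic_parry_polynomial_of (t : nat -> int) (n : {poly int}) :
  parry_polynomial_of t n -> n \is monic.
Proof.
case/parry_polynomial_ofE => [[m _ ->]|[m [p [_ ->]]]].
  exact: monic_remainder_poly.
by rewrite monic_remainder_polyB // addnS ltnS leq_addr.
Qed.

Lemma coef0_parry_polynomial_of_neq0 (t : nat -> int) (n : {poly int}) :
  (forall i, 0 <= t i) -> parry_polynomial_of t n -> n`_0 != 0.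
Proof.
move=> t_ge0 /parry_polynomial_ofE [[m [m_gt0 tm _] ->]|].
  by case: m m_gt0 tm => // m _ /eqP; rewrite coef0_remainder_poly oppr_eq0.
move=> [[|m] [p [t_per ->]]]; rewrite coefB !coef0_remainder_poly /=.
  by rewrite -opprD oppr_eq0 gt_eqF // ltr_wpDl.
by rewrite opprK addrC subr_eq0 eq_sym minimally_periodic_preperiod_neq.
Qed.

Lemma renyi_digit_ge0 (R : realType) (beta : R) :
  0 <= beta -> forall i, 0 <= renyi_digit beta i.
Proof.
move=> beta_ge0 i; rewrite /renyi_digit floor_ge0 mulr_ge0 //.
by case: i.-1 => [|k] //=; rewrite /beta_transform subr_ge0 floor_le.
Qed.

Theorem theorem3p18 (R : realType) (beta : R) (n P : {poly int}) :
  parry_number beta ->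
  parry_polynomial beta n ->
  minimal_polynomial beta P ->
  forall q : {poly int},
    irreducible_Zpoly q ->
    divides_Zpoly q n ->
    ~ associated_Zpoly q P ->
    ~ cyclotomic_Zpoly q ->
    exists2 z : complex R, root (map_poly intr q) z & 1 < `|z|.
Proof.
move=> [beta_gt1 _ _] n_parry _ q q_irr [r n_def] _ q_ncyc.
have beta_ge0 : 0 <= beta by rewrite ltW // (lt_trans ltr01).
have q_lead : lead_coef q \is a GRing.unit.
  have /monicP := monic_parry_polynomial_of n_parry.
  by rewrite n_def lead_coefM => lead1; apply/unitrPr; exists (lead_coef r).
have q0_neq0 : q`_0 != 0.
  have := coef0_parry_polynomial_of_neq0 (renyi_digit_ge0 beta_ge0) n_parry.
  by rewrite n_def coef0M mulf_eq0 negb_or => /andP [].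
apply: contrapT => no_root_out; apply: q_ncyc.
apply: (@irreducible_in_unit_disk_cyclotomic (complex R)) => // z qz.
rewrite real_leNgt ?normr_real ?real1 //.
by apply/negP => z_gt1; apply: no_root_out; exists z.
Qed.
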